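(* For each $l>0$ let $w_l\in\mathcal W_l$ be a minimizer of $F^l$ over $\mathcal W_l$, and let $X_l=\{x_1,\dots,x_{N_l}\}\in\mathcal{AD}_l$ be a corresponding configuration of dislocations, i.e. such that $w_l=w_{u_{X_l}}$ (for a suitable choice of the additive constant in $u_{X_l}$). Then, setting $\mu_l:=\frac1l\sum_{i=1}^{N_l}\delta_{\frac{x_i}{l}}$ (where $\delta_{a}$ denotes the Dirac mass at $a$), we have $$\mu_l\stackrel{*}{\rightharpoonup}\frac{\lambda}{\delta(\Lambda+\lambda)}\,dx\qquad\text{as } l\to+\infty,$$ weakly-$*$ as measures on $(0,1)$, where $dx$ is the Lebesgue measure on $(0,1)$.
   Context: Fix constants $\lambda,\Lambda>0$ with $\Lambda\ge\lambda$, and $\delta>0$. For $l>0$ let $\mathcal{AD}_l$ be the family of finite sets $X=\{x_1,\dots,x_N\}\subset(-\frac\delta2,\,l+\frac\delta2)$, $N\in\mathbb N$, $x_1<x_2<\dots<x_N$, such that the intervals $(x_i-\frac\delta2,x_i+\frac\delta2)$ are mutually disjoint; the empty set is also allowed, $\emptyset\in\mathcal{AD}_l$. For $X\in\mathcal{AD}_l$, $u_X\in W^{1,\infty}(0,l)$ denotes a function, determined up to an additive constant, with $$u_X'=\lambda-(\Lambda+\lambda)\,\chi_{(0,l)}\sum_{i=1}^N\chi_{(x_i-\frac\delta2,x_i+\frac\delta2)}.$$ Let $\mathcal U_l:=\{u_X : X\in\mathcal{AD}_l\}$ (all choices of additive constants are included). Rescaled displacements: $\mathcal W_l:=\{w_u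 : u\in\mathcal U_l\}\subset W^{1,\infty}(0,1)$, where $w_u(z):=\frac{u(lz)}{\sqrt l}$ for $z\in(0,1)$. Energy: $F^l(w):=\int_0^1\int_0^1\frac{|w(x)-w(y)|^2}{|x-y|^2}\,dx\,dy$ for $w\in\mathcal W_l$. Weak-$*$ convergence of measures on $(0,1)$ is tested against continuous functions with compact support in $(0,1)$. *)

(* Defs.v *)
From HB Require Import structures.
From mathcomp Require Import all_boot all_order all_algebra.
From mathcomp Require Import finmap.
From mathcomp Require Import all_classical all_reals all_analysis.

Set Implicit Arguments.
Unset Strict Implicit.
Unset Printing Implicit Defensive.

Import Order.TTheory GRing.Theory Num.Theory.
Import numFieldNormedType.Exports.

Local Open Scope classical_set_scope.
Local Open Scope ring_scope.

(* Functions on an open interval `]a, b[ are represented by functions R -> R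
   whose values outside the interval are irrelevant. *)

Section sobolev.
Context {R : realType}.
Implicit Types (a b : R) (u g phi : R -> R).

Definition compact_support_in a b phi : Prop :=
  compact (closure [set x | phi x != 0]) /\
  closure [set x | phi x != 0] `<=` `]a, b[.

(* C^1_c(a, b), extended by 0 to the whole line. *)
Definition C1c a b phi : Prop :=
  [/\ forall x, derivable phi x 1, continuous (derive1 phi)
    & compact_support_in a b phi].

Definition Linfty a b u : Prop :=
  measurable_fun `]a, b[ u /\
  exists M : R, {ae (@lebesgue_measure R),
    forall x, x \in `]a, b[ -> `|u x| <= M}.

Definition weak_derivative a b u g : Prop :=
  forall phi, C1c a b phi ->
    \int[@lebesgue_measure R]_(x in `]a, b[) (u x * derive1 phi x) =
    - \int[@lebesgue_measure R]_(x in `]a, b[) (g x * phi x).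

(* u is in W^{1,oo}(a, b) and u' = g. *)
Definition W1infty_derivative a b u g : Prop :=
  [/\ Linfty a b u, Linfty a b g & weak_derivative a b u g].

End sobolev.

Section dislocations.
Context {R : realType}.
Implicit Types (lambda Lambda delta l : R) (X : {fset R}) (u w : R -> R).

Definition core delta (x : R) : set R := `]x - delta / 2, x + delta / 2[.

Definition AD delta l : set {fset R} := [set X : {fset R} |
  (forall x : R, x \in X -> - (delta / 2) < x < l + delta / 2) /\
  trivIset [set` X] (core delta)].

Definition slope lambda Lambda delta l X (x : R) : R :=
  lambda - (Lambda + lambda) *
    (\1_`]0, l[ x * \sum_(y <- X) \1_(core delta y) x).

Definition is_displacement lambda Lambda delta l X u : Prop :=
  W1infty_derivative 0 l u (slope lambda Lambda delta l X).

Definition displacements lambda Lambda delta l : set (R -> R) :=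
  [set u | exists2 X, AD delta l X & is_displacement lambda Lambda delta l X u].

Definition rescale l u : R -> R := fun z => u (l * z) / Num.sqrt l.

Definition rescaled_displacements lambda Lambda delta l : set (R -> R) :=
  rescale l @` displacements lambda Lambda delta l.

Definition energy w : \bar R :=
  (\int[@lebesgue_measure R]_(y in `]0%R, 1%R[)
     \int[@lebesgue_measure R]_(x in `]0%R, 1%R[)
       (`|w x - w y| ^+ 2 / `|x - y| ^+ 2)%:E)%E.

Definition energy_minimizer lambda Lambda delta l w : Prop :=
  rescaled_displacements lambda Lambda delta l w /\
  forall v, rescaled_displacements lambda Lambda delta l v ->
    (energy w <= energy v)%E.

(* measurableTypeR R is R with the sigma-algebra carried by lebesgue_measure. *)
Local Notation measureR := {measure set (measurableTypeR R) -> \bar R}.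

(* (1/l) * sum_(x in X) dirac (x / l), for l > 0; the absolute value only
   serves to make the scaling factor nonnegative for every l. *)
Definition dislocation_measure l X : measureR :=
  mscale `|l^-1|%:nng
    (msum (fun i => dirac (X`_i / l : measurableTypeR R) : measureR) #|` X|).

(* Weak-* convergence of measures on (0, 1) as l -> +oo. *)
Definition weak_star_cvg (mu : R -> measureR) (nu : measureR) : Prop :=
  forall phi : R -> R, continuous phi -> compact_support_in 0 1 phi ->
    \int[mu l]_(x in `]0, 1[) phi x @[l --> +oo] -->
    \int[nu]_(x in `]0, 1[) phi x.

End dislocations.

(* Main.v *)
Require Import Defs.
From HB Require Import structures.
From mathcomp Require Import all_boot all_order all_algebra.
From mathcomp Require Import finmap.
From mathcomp Require Import all_classical all_reals all_analysis.
From mathcomp Require Import measurable_realfun ring lra.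

Set Implicit Arguments.
Unset Strict Implicit.
Unset Printing Implicit Defensive.

Import Order.TTheory GRing.Theory Num.Theory.
Import numFieldNormedType.Exports.

Local Open Scope classical_set_scope.
Local Open Scope ring_scope.

(** In the unscaled variable the energy is [1/l] times the integral over
    ]0, l[ x ]0, l[ of [|u x - u y|^2 / |x - y|^2].  Placing the cores
    periodically, with period [p = delta (Lambda + lambda) / lambda], makes
    the slope average to zero over each period; the displacement is then
    bounded and Lipschitz uniformly in [l], so the integrand is at most a
    constant times [1 / (1 + (x - y)^2)] and the energy is at most a constant
    [C] that does not depend on [l] ([bounded_energy_competitor]).  Hence the
    minimizers satisfy [energy (w l) <= C].

    A bounded energy forces the slope to vanish in the mean.  Indeed, since
    [|x - y| <= 1] on the unit square, the energy dominates the integral of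
    [|w x - w y|^2]; so if [energy w <= C], if [|h| <= M] and if [h] has
    integral zero, then the integral of [w h] is at most [M^2 + C] in absolute
    value ([energy_bounds_pairing]).  Take [h = g'] with [g] a test function
    on ]0, 1[, and use [x |-> g (x / l)] as a test function in the weak
    formulation of [u' = slope].  As [u (l z) = sqrt l * w z], the integral of
    the slope against [g (x / l)] is O(sqrt l), which is negligible compared
    with the length [l] of the interval ([slope_defect]).  In other words the
    total integral of [g (x / l)] over the cores is
    [l lambda / (Lambda + lambda)] times the integral of [g], up to O(sqrt l).

    It remains to replace the integral over the core around [y] by
    [delta * phi (y / l)], which costs little because the cores have width
    [delta / l] after rescaling and [phi] is uniformly continuous.  The
    errors add up to O(l) times a small number since disjointness bounds the
    number of cores by [l / delta + 2] ([core_averages], [card_AD]).  Finally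
    a continuous [phi] with compact support is uniformly approximated by
    C^1 test functions [g] ([C1c_dense]). *)

(** * Continuous functions of compact support *)

Section test_functions.
Context {R : realType}.
Implicit Types (a b l : R) (phi f : R -> R).

(** The closure of the support misses [a] and [b], hence a ball around each:
    a usable form of compact support, with a margin [eta] at both ends. *)
Lemma compact_support_inP a b phi :
  compact_support_in a b phi <->
  exists2 eta, 0 < eta & forall x, ~~ (a + eta <= x <= b - eta) -> phi x = 0.
Proof.
split=> [[_ sub]|[eta eta0 phi0]].
- have away c : c \notin `]a, b[ ->
      exists2 eta, 0 < eta & forall x, `|c - x| < eta -> phi x = 0.
    move=> cab; have : (~` closure [set x | phi x != 0]) c.
      by move/sub => /= c'; rewrite c' in cab.
    rewrite -interiorC => /nbhs_ballP[eta /= eta0 etaP].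
    exists eta => // x cx; have /= /negP := etaP x cx.
    by rewrite negbK => /eqP.
  have [|e1 e10 h1] := away a; first by rewrite in_itv/= ltxx.
  have [|e2 e20 h2] := away b; first by rewrite in_itv/= ltxx andbF.
  exists (Num.min e1 e2 / 2) => [|x]; first by rewrite divr_gt0// lt_min e10.
  have [xab|xab _] := boolP (x \in `]a, b[); last first.
    apply/eqP/negP => /negP phix; move/negP : xab; apply.
    by apply: sub; exact: subset_closure.
  have m1 : Num.min e1 e2 <= e1 by rewrite ge_min lexx.
  have m2 : Num.min e1 e2 <= e2 by rewrite ge_min lexx orbT.
  have m0 : 0 < Num.min e1 e2 by rewrite lt_min e10.
  move: xab; rewrite in_itv/= => /andP[ax xb].
  rewrite negb_and -!ltNge => /orP[h|h].
    apply: h1; rewrite ltr0_norm ?subr_lt0//.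
    by move: (Num.min e1 e2) h m1 m2 m0 => m; lra.
  apply: h2; rewrite gtr0_norm ?subr_gt0//.
  by move: (Num.min e1 e2) h m1 m2 m0 => m; lra.
- have sub : closure [set x | phi x != 0] `<=` `[a + eta, b - eta].
    have /closure_id -> := @itv_closed _ R (a + eta) (b - eta).
    apply: closureS => x /= phix; rewrite in_itv/=; apply: contraNT phix.
    by move=> /phi0 ->.
  split.
    have cK := @segment_compact R (a + eta) (b - eta).
    by apply: (subclosed_compact _ cK sub); exact: closed_closure.
  apply: (subset_trans sub) => x /=; rewrite !in_itv/= => /andP[? ?].
  by apply/andP; split; lra.
Qed.

(** Near-covering compactness of the segment [a, b] makes the modulus of
    continuity uniform there; outside the segment the function vanishes. *)
Lemma compact_support_unif_cont a b phi (e : R) :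
  continuous phi -> compact_support_in a b phi -> 0 < e ->
  exists2 eta, 0 < eta & forall x y, `|x - y| < eta -> `|phi x - phi y| <= e.
Proof.
move=> cphi /compact_support_inP[eta0 eta00 phi0] e0.
have /compact_near_coveringP cov := @segment_compact R a b.
have [|eta /= eta_gt0 etaP] := cov _ (0:R)^'+
    (fun r x => forall y, `|x - y| < r -> `|phi x - phi y| <= e) _.
  move=> x _.
  have /cvgr_dist_lt/(_ (e / 2)) := cphi x.
  rewrite divr_gt0// => /(_ isT)/nbhs_ballP[d /= d0 dP].
  near=> x' r => y xy.
  have xx' : `|x - x'| < d / 2.
    by near: x'; apply: nbhsx_ballx; rewrite divr_gt0.
  have rd : r < d / 2.
    by near: r; apply: nbhs_right_lt; rewrite divr_gt0.
  have d_gt0 : 0 < d := d0.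
  have /dP p1 : `|x - x'| < d by lra.
  have /dP p2 : `|x - y| < d.
    rewrite (le_lt_trans (ler_distD x' x y))// (splitr d) ltrD//.
    exact: lt_trans xy rd.
  rewrite (le_trans (ler_distD (phi x) _ _))// (splitr e) ltW// ltrD//.
  by rewrite distrC.
pose r := eta / 2.
have r0 : 0 < r by rewrite divr_gt0.
have main x y : x \in `[a, b] -> `|x - y| < r -> `|phi x - phi y| <= e.
  move=> xab xy; apply: (etaP r) => //=.
  by rewrite sub0r normrN gtr0_norm// /r gtr_pMr// invf_lt1// ltr1n.
exists r => // x y xy.
have [xab|xab] := boolP (x \in `[a, b]); first exact: main.
have [yab|yab] := boolP (y \in `[a, b]).
  by rewrite distrC main// distrC.
have out z : z \notin `[a, b] -> phi z = 0.
  move=> zab; apply: phi0; apply: contraNN zab; rewrite in_itv/= => /andP[? ?].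
  by apply/andP; split; lra.
by rewrite !out// subrr normr0 ltW.
Unshelve. all: by end_near. Qed.

End test_functions.

Section mollification.
Context {R : realType}.
Notation mu := (@lebesgue_measure R).
Implicit Types (a b l : R) (phi g : R -> R).

Lemma compact_support_integrable a b phi :
  continuous phi -> compact_support_in a b phi ->
  mu.-integrable setT (EFin \o phi).
Proof.
move=> cphi /compact_support_inP[eta eta0 phi0].
have -> : phi = phi \_ `[a, b].
  apply/funext => x; rewrite patchE; case: ifPn => // xab.
  apply: phi0; apply: contraNN xab => /andP[? ?]; rewrite inE/= in_itv/=.
  by apply/andP; split; lra.
have mab : measurable (`[a, b] : set (measurableTypeR R)) by [].
rewrite -restrict_EFin; apply: (integrable_mkcond _ mab).1.
have cK := @segment_compact R a b.
exact: (@continuous_compact_integrable R phi _ cK (continuous_subspaceT cphi)).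
Qed.

Lemma compact_support_antiderivative a b phi :
  continuous phi -> compact_support_in a b phi ->
  exists F : R -> R, forall x : R, is_derive x (1 : R) F (phi x).
Proof.
move=> cphi sphi; exists (fun x => \int[mu]_(t in `]-oo, x]) phi t) => x.
have [|||dF F'] := @continuous_FTC1 R phi -oo%O x (x + 1) _ _ _ (cphi x).
- by rewrite ltrDl.
- apply: integrableS (compact_support_integrable cphi sphi) => //.
- exact: ltNye.
- by apply: (DeriveDef dF); rewrite -derive1E; exact: F'.
Qed.

(** The moving average of [phi] over a window of half-width [h] is C^1, and by
    the mean value theorem each of its values is a value of [phi] at distance
    less than [h]; this gives at once the uniform estimate and, when [h] is
    less than the margin of the support, the compact support. *)
Lemma C1c_dense a b phi (e : R) :
  continuous phi -> compact_support_in a b phi -> 0 < e ->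
  exists2 g, C1c a b g & forall x, `|g x - phi x| <= e.
Proof.
move=> cphi sphi e0.
have [F dF] := compact_support_antiderivative cphi sphi.
have [r r0 rP] := compact_support_unif_cont cphi sphi e0.
have /compact_support_inP[eta eta0 phi0] := sphi.
pose h := Num.min (eta / 2) r.
have h0 : 0 < h by rewrite lt_min divr_gt0.
have hr : h <= r by rewrite ge_min lexx orbT.
have he : h <= eta / 2 by rewrite ge_min lexx.
pose g x := (F (x + h) - F (x - h)) / (2 * h).
have dF' (x c : R) : is_derive x (1 : R) (fun x => F (x + c)) (phi (x + c)).
  have := @is_derive1_comp R F (shift c) x _ _ (dF (x + c))
    (is_derive_shift x 1 c).
  by rewrite mulr1.
have dg (x : R) : is_derive x (1 : R) g ((phi (x + h) - phi (x - h)) / (2 * h)).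
  rewrite mulrC /g.
  rewrite [X in is_derive _ _ X](_ : _ =
    (2 * h)^-1 *: ((fun x => F (x + h)) - (fun x => F (x - h)))); last first.
    by apply/funext => y /=; rewrite mulrC.
  apply: is_deriveZ.
have g'E : derive1 g = fun x => (phi (x + h) - phi (x - h)) / (2 * h).
  by apply/funext => x; rewrite derive1E; exact: derive_val.
have gmean x : exists2 c, `|c - x| < h & g x = phi c.
  have [||c] := @MVT R F phi (x - h) (x + h).
  - by lra.
  - apply: continuous_subspaceT => z; apply: differentiable_continuous.
    by apply/derivable1_diffP; have [] := dF z.
  - rewrite in_itv/= => /andP[c1 c2] FE; exists c.
      by rewrite ltr_norml; apply/andP; split; lra.
    rewrite /g FE; field; lra.
exists g.
- split.
  + by move=> x; have [] := dg x.
  + have cshift c : continuous (fun x => phi (x + c)).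
      move=> x; apply: (@continuous_comp _ _ _ (shift c) phi); last exact: cphi.
      by apply: cvgD; [exact: cvg_id|exact: cvg_cst].
    by rewrite g'E => x; apply: cvgMr_tmp; apply: cvgB; exact: cshift.
  + apply/compact_support_inP; exists (eta / 2); first by rewrite divr_gt0.
    move=> x xab; have [c] := gmean x; rewrite ltr_norml => /andP[c1 c2] ->.
    apply: phi0; apply: contraNN xab => /andP[? ?].
    by apply/andP; split; lra.
- by move=> x; have [c cx ->] := gmean x; apply: rP; exact: lt_le_trans hr.
Qed.

Lemma derive1_dilation l g (x : R) : derivable g (x / l) 1 ->
  is_derive x (1 : R) (fun x => g (x / l)) (derive1 g (x / l) / l).
Proof.
move=> dg; rewrite derive1E.
have dgx : is_derive (x / l) (1 : R) g ('D_1 g (x / l)) by exact/derivableP.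
have dl : is_derive x (1 : R) ( *%R^~ l^-1 : R -> R) l^-1.
  have -> : *%R^~ l^-1 = l^-1 \*: (@id R) :> (R -> R).
    by apply/funext => y /=; rewrite mulrC.
  by rewrite -[X in is_derive _ _ _ X]mulr1; exact: is_deriveZ.
exact: (@is_derive1_comp R g ( *%R^~ l^-1) x _ _ dgx dl).
Qed.

Lemma C1c_dilation l g : 0 < l -> C1c 0 1 g -> C1c 0 l (fun x => g (x / l)).
Proof.
move=> l0 [dg cg sg]; split.
- by move=> x; have [] := derive1_dilation (dg (x / l)).
- rewrite (_ : derive1 _ = fun x => derive1 g (x / l) / l).
    have cdil : continuous (fun x : R => derive1 g (x / l)).
      move=> x; have c1 : {for x, continuous ( *%R^~ l^-1 : R -> R)}.
        exact: mulrr_continuous.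
      exact: (@continuous_comp R R R _ (derive1 g) x c1 (cg _)).
    by move=> x; apply: cvgMr_tmp; exact: cdil.
  apply/funext => x; rewrite derive1E; have d := derive1_dilation (dg (x / l)).
  exact: derive_val.
- move/compact_support_inP : sg => [eta eta0 g0].
  apply/compact_support_inP; exists (eta * l); first exact: mulr_gt0.
  move=> x xab; apply: g0; apply: contraNN xab.
  by rewrite ler_pdivlMr// ler_pdivrMr// mulrBl mulrDl !mul0r mul1r.
Qed.

End mollification.

(** * Integrals: monotonicity, dilations, essentially bounded functions *)

(** [Linfty] speaks of the bare set function [lebesgue_measure], from which the
    filter instance of a measure is not inferred. *)
#[local] Instance ae_lebesgue_filter (R : realType) :
  Filter (nbhs (almost_everywhere (@lebesgue_measure R))).
Proof.
exact: (ae_filter_ringOfSetsType (@lebesgue_measure R : measure _ R)).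
Qed.

Section integration.
Context {R : realType}.
Notation mu := (@lebesgue_measure R).

Section measurability_free.
Context d (T : measurableType d) (m : {measure set T -> \bar R}).

Import HBNNSimple.

(** The integral of a nonnegative function is a supremum over the simple
    functions below it, so it is monotone without any measurability.  This
    dispenses with the measurability in [y] of the inner integral of the
    energy. *)
Lemma nonneg_le_integral (D : set T) (f g : T -> \bar R) :
  (forall x, D x -> 0 <= f x <= g x)%E ->
  (\int[m]_(x in D) f x <= \int[m]_(x in D) g x)%E.
Proof.
move=> fg; rewrite integral_mkcond [leRHS]integral_mkcond.
have fgD x : (0 <= (f \_ D) x <= (g \_ D) x)%E.
  by rewrite !patchE; case: ifPn => [|_]; rewrite ?inE ?lexx//; exact: fg.
have f0 x : (0 <= (f \_ D) x)%E by have /andP[] := fgD x.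
have g0 x : (0 <= (g \_ D) x)%E by have /andP[/le_trans h /h] := fgD x.
rewrite !ge0_integralTE//; apply: ereal_sup_le => _ [h hf <-]; exists h => // x.
by have /andP[_] := fgD x; exact: le_trans.
Qed.

End measurability_free.

Lemma dilation_itv (l x : R) : 0 < l -> x \in `]0, 1[ -> l * x \in `]0, l[.
Proof.
move=> l0; rewrite !in_itv/= => /andP[x0 x1].
by rewrite mulr_gt0//= -[ltRHS]mulr1 ltr_pM2l.
Qed.

(** The scaled pushforward of the Lebesgue measure agrees with the Lebesgue
    measure on half-open intervals, which determine it. *)
Lemma lebesgue_measure_dilation (l : R) (A : set (measurableTypeR R)) :
  0 < l -> measurable A -> mu A = (l%:E * mu ( *%R l @^-1` A))%E.
Proof.
move=> l0 mA.
have mphi : measurable_fun [set: measurableTypeR R]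
    ( *%R l : _ -> measurableTypeR R).
  exact: mulrl_measurable.
pose nu : {measure set (measurableTypeR R) -> \bar R} :=
  mscale (NngNum (ltW l0)) (pushforward mu ( *%R l : _ -> measurableTypeR R)).
rewrite [LHS](@lebesgue_measure_unique _ (nu mphi))// => _ [[a b]] _ <-.
rewrite [RHS](_ : _ = (l%:E * mu (`](a / l)%R, (b / l)%R]%classic : set R))%E).
  rewrite !lebesgue_measure_itv/= !lte_fin ltr_pM2r ?invr_gt0//.
  case: ifPn => _; last by rewrite mule0.
  by rewrite -EFinM -!EFinB; congr EFin; field; rewrite gt_eqF.
rewrite /= /mscale /pushforward/=; congr (_ * mu _)%E.
apply/seteqP; split=> x /=; rewrite !in_itv/=.
  by rewrite ltr_pdivrMr// ler_pdivlMr// ![x * l]mulrC.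
by rewrite ltr_pdivrMr// ler_pdivlMr// ![x * l]mulrC.
Qed.

Lemma ge0_integral_dilation (l : R) (f : R -> \bar R) : 0 < l ->
  measurable_fun [set: R] f -> (forall x, 0 <= f x)%E ->
  (\int[mu]_x f x = l%:E * \int[mu]_x f (l * x)%R)%E.
Proof.
move=> l0 mf f0.
have mphi : measurable_fun [set: measurableTypeR R]
    ( *%R l : _ -> measurableTypeR R).
  exact: mulrl_measurable.
rewrite -[X in (_ * \int[_]_(x in X) _)%E](preimage_setT ( *%R l)).
rewrite -(@ge0_integral_pushforward _ _ _ _ _ _ mphi mu setT f)//.
have -> : l%:E = (NngNum (ltW l0))%:num%:E by [].
rewrite -ge0_integral_mscale//; apply: eq_measure_integral => A mA _.
exact: lebesgue_measure_dilation.
Qed.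

(** Holds for infinite [x] and [y] too, as [fine] sends the infinities to 0;
    so scaling a real-valued integral needs no integrability. *)
Lemma fineZB (k : R) (x y : \bar R) : 0 <= k ->
  fine (k%:E * x - k%:E * y)%E = k * fine (x - y)%E.
Proof.
rewrite le_eqVlt => /predU1P[<-|k0]; first by rewrite !mul0e subee// mul0r.
have kE : (0 < k%:E)%E by rewrite lte_fin.
by case: x => [x||]; case: y => [y||];
  rewrite ?gt0_muley ?gt0_muleNy//= ?mulr0// mulrBr.
Qed.

Lemma Rintegral_mscale d (T : measurableType d) (m : {measure set T -> \bar R})
    (k : {nonneg R}) (D : set T) (f : T -> R) :
  measurable D -> measurable_fun D f ->
  \int[mscale k m]_(x in D) f x = k%:num * \int[m]_(x in D) f x.
Proof.
move=> mD mf; have mEf : measurable_fun D (EFin \o f) by exact/measurable_EFinP.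
rewrite /Rintegral integralE [in RHS]integralE.
rewrite (ge0_integral_mscale _ _ _ (measurable_funepos mEf))//.
rewrite (ge0_integral_mscale _ _ _ (measurable_funeneg mEf))//.
exact: fineZB.
Qed.

(** Change of variables for functions that are merely integrable, as needed
    for a displacement, which its definition pins down only almost
    everywhere. *)
Lemma Rintegral_dilation (l : R) (f : R -> R) : 0 < l ->
  mu.-integrable `]0, l[ (EFin \o f) ->
  \int[mu]_(x in `]0, l[) f x = l * \int[mu]_(x in `]0, 1[) f (l * x).
Proof.
move=> l0 intf.
pose F := (EFin \o f) \_ `]0, l[.
have mI : measurable (`]0, l[ : set (measurableTypeR R)) by [].
have intF : mu.-integrable setT F by exact: (integrable_mkcond _ mI).1.
have FE : (fun x => (f (l * x))%:E) \_ `]0, 1[ = fun x => F (l * x).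
  apply/funext => x; rewrite /F !patchE /=; congr (if _ then _ else _).
  apply/esym.
  have lx : (l * x < l) = (x < 1) by rewrite -[X in _ < X]mulr1 ltr_pM2l.
  by apply/idP/idP; rewrite !inE/= !in_itv/= pmulr_rgt0// lx.
have mF : measurable_fun setT F by exact: measurable_int intF.
rewrite /Rintegral integral_mkcond [in RHS]integral_mkcond -/F FE.
rewrite integralE [in RHS]integralE.
rewrite (ge0_integral_dilation l0 (measurable_funepos mF))//.
rewrite (ge0_integral_dilation l0 (measurable_funeneg mF))//.
by rewrite (fineZB _ _ (ltW l0)); congr (_ * fine (_ - _));
  apply: eq_integral => x _; rewrite ?funeposE ?funenegE.
Qed.

Lemma Linfty_integrable (a b : R) (u : R -> R) :
  Linfty a b u -> mu.-integrable `]a, b[ (EFin \o u).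
Proof.
move=> [mu_ [M uM]]; apply/integrableP; split; first exact/measurable_EFinP.
have mab : measurable (`]a, b[ : set (measurableTypeR R)) by [].
have M0 : (0 <= `|M|%:E)%E by rewrite lee_fin.
have muM : {ae mu, forall x, `]a, b[%classic x ->
    (`|(EFin \o u) x| <= `|M|%:E)%E}.
  apply: filterS uM => x xM xab; rewrite /= lee_fin.
  by rewrite (le_trans (xM xab))// ler_norm.
have mEu : measurable_fun `]a, b[ (EFin \o u) by exact/measurable_EFinP.
apply: le_lt_trans (integral_le_bound _ mab mEu M0 muM) _.
rewrite /= lebesgue_measure_itv/=; case: ifPn => _; last by rewrite mule0 ltry.
by rewrite -EFinB -EFinM ltry.
Qed.

Lemma LinftyM (a b : R) (u v : R -> R) :
  Linfty a b u -> Linfty a b v -> Linfty a b (u \* v).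
Proof.
move=> [mu_ [M uM]] [mv [N vN]]; split; first exact: measurable_funM.
exists (M * N); apply: filterS2 uM vN => x xM xN xab.
by rewrite normrM ler_pM// ?xM// xN.
Qed.

Lemma ae_dilation (l : R) (P : R -> Prop) : 0 < l ->
  {ae mu, forall x, P x} -> {ae mu, forall x, P (l * x)}.
Proof.
move=> l0 [A [mA A0 PA]]; exists ( *%R l @^-1` A); split.
- by rewrite -[X in measurable X]setTI; apply: mulrl_measurable.
- have /eqP := lebesgue_measure_dilation l0 mA.
  rewrite A0 eq_sym mule_eq0 eqe gt_eqF//= => /eqP.
  exact.
- by move=> x /= Px; apply: PA.
Qed.

Lemma Linfty_dilation (l : R) (u : R -> R) : 0 < l ->
  Linfty 0 l u -> Linfty 0 1 (fun x => u (l * x)).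
Proof.
move=> l0 [mu_ [M uM]]; split.
  have mI : measurable (`]0, l[ : set R) by [].
  have sub : [set l * x | x in `]0, 1[] `<=` `]0, l[.
    by move=> _ [x xI <-]; exact: dilation_itv.
  exact: (measurable_comp mI sub mu_ (mulrl_measurable l)).
exists M; have := ae_dilation l0 uM; apply: filterS => x xM xI.
by apply: xM; exact: dilation_itv.
Qed.

Lemma bounded_Linfty (a b : R) (u : R -> R) (M : R) :
  measurable_fun `]a, b[ u -> (forall x, x \in `]a, b[ -> `|u x| <= M) ->
  Linfty a b u.
Proof.
by move=> mu_ uM; split=> //; exists M; apply: nearW => x; exact: uM.
Qed.
Lemma cst_Linfty (a b c : R) : Linfty a b (fun _ => c).
Proof. by apply: (bounded_Linfty (M := `|c|)). Qed.

Lemma LinftyZ (a b c : R) (f : R -> R) :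
  Linfty a b f -> Linfty a b (fun x => c * f x).
Proof. exact: (LinftyM (cst_Linfty a b c)). Qed.

Lemma LinftyB (a b : R) (f g : R -> R) :
  Linfty a b f -> Linfty a b g -> Linfty a b (f \- g).
Proof.
move=> [mf [M fM]] [mg [N gN]]; split; first exact: measurable_funB.
exists (M + N); apply: filterS2 fM gN => x xM xN xab.
by rewrite (le_trans (ler_normB _ _))// lerD// ?xM// xN.
Qed.

Lemma Linfty_sum (a b : R) (I : Type) (s : seq I) (F : I -> R -> R) :
  (forall i, Linfty a b (F i)) -> Linfty a b (fun x => \sum_(i <- s) F i x).
Proof.
move=> LF; elim: s => [|i s IHs].
  by under eq_fun do rewrite big_nil; exact: cst_Linfty.
under eq_fun do rewrite big_cons.
have := LinftyB (LF i) (LinftyM (cst_Linfty a b (-1)) IHs).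
by congr Linfty; apply/funext => x /=; rewrite mulN1r opprK.
Qed.

Lemma continuous_bounded_oo (a b : R) (f : R -> R) : continuous f ->
  exists M, forall x, x \in `]a, b[ -> `|f x| <= M.
Proof.
move=> cf; have /compact_bounded[M [_ fM]] : compact (f @` `[a, b]).
  apply: continuous_compact; last exact: segment_compact.
  exact: continuous_subspaceT.
exists (M + 1) => x xab; apply: (fM (M + 1)); first by rewrite ltrDl.
by exists x => //=; exact: subset_itv_oo_cc.
Qed.

Lemma continuous_Linfty (a b : R) (f : R -> R) : continuous f -> Linfty a b f.
Proof.
move=> cf; have [M fM] := continuous_bounded_oo a b cf.
apply: bounded_Linfty fM.
exact: measurable_funTS (continuous_measurable_fun cf).
Qed.

End integration.

(** * What a bound on the energy gives *)

Section energy_lower_bound.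
Context {R : realType}.
Notation mu := (@lebesgue_measure R).

Lemma lebesgue_measure_unit_interval : mu (`]0, 1[ : set R) = 1%E.
Proof. by rewrite lebesgue_measure_itv/= lte_fin ltr01 -EFinB subr0. Qed.

(** For each fixed [y], the hypothesis that [g] has mean zero allows to replace
    [w x] by [w x - w y] in the pairing, and
    [|w x - w y| |g x| <= M^2 + |w x - w y|^2], where the last term increases
    when it is divided by [|x - y|^2 <= 1].  Averaging over [y] gives the
    energy. *)
Lemma energy_bounds_pairing (w g : R -> R) (M C : R) :
  Linfty 0 1 w -> measurable_fun (`]0, 1[ : set R) g ->
  (forall x, x \in `]0, 1[ -> `|g x| <= M) ->
  \int[mu]_(x in `]0, 1[) g x = 0 -> (energy w <= C%:E)%E ->
  `|\int[mu]_(x in `]0, 1[) (w x * g x)| <= M ^+ 2 + C.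
Proof.
move=> Lw mg gM g0 wC; set c := `|_|.
have mI : measurable (`]0, 1[ : set (measurableTypeR R)) by [].
have Lg : Linfty 0 1 g by exact: bounded_Linfty gM.
have key y : y \in `]0, 1[ -> (c%:E <= (M ^+ 2)%:E +
    \int[mu]_(x in `]0%R, 1%R[) (`|w x - w y| ^+ 2 / `|x - y| ^+ 2)%:E)%E.
  move=> yI; pose f x := (w x - w y) * g x.
  have Lwg := LinftyM Lw Lg.
  have Lwyg := LinftyM (cst_Linfty 0 1 (w y)) Lg.
  have iwg := Linfty_integrable Lwg.
  have iwyg := Linfty_integrable Lwyg.
  have mw : measurable_fun (`]0, 1[ : set R) (fun x => w x - w y).
    by apply: measurable_funB => //; case: Lw.
  have intf : mu.-integrable `]0, 1[ (EFin \o f).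
    rewrite (_ : EFin \o f = (fun x => ((w \* g) x)%:E -
      (((fun _ => w y) \* g) x)%:E)%E).
      exact: integrableB.
    by apply/funext => x; rewrite /f /= mulrBl EFinB.
  have -> : c = `|\int[mu]_(x in `]0, 1[) f x|.
    rewrite /f; under [in RHS]eq_Rintegral do rewrite mulrBl.
    rewrite RintegralB// RintegralZl//; last exact: Linfty_integrable.
    by rewrite g0 mulr0 subr0.
  rewrite EFin_normr_Rintegral//.
  have mf := measurable_int _ intf.
  apply: (le_trans (le_abse_integral mu mI mf)).
  apply: (@le_trans _ _ (\int[mu]_(x in `]0%R, 1%R[)
     ((M ^+ 2)%:E + (`|w x - w y| ^+ 2)%:E))%E).
    apply: nonneg_le_integral => x /= xI; rewrite lee_fin normr_ge0/=.
    rewrite -EFinD lee_fin /f normrM.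
    have := gM x xI; have := normr_ge0 (g x); have := normr_ge0 (w x - w y).
    move: `|w x - w y| `|g x| => s t s0 t0 tM.
    have := sqr_ge0 (s - t); have := mulr_ge0 s0 t0.
    have := ler_pM t0 t0 tM tM; rewrite !expr2; nra.
  have msq : measurable_fun (`]0, 1[ : set R) (fun x => (`|w x - w y| ^+ 2)%:E).
    by apply/measurable_EFinP; apply: measurable_funX; exact: measurableT_comp.
  have M20 : (0 <= (M ^+ 2)%:E)%E by rewrite lee_fin sqr_ge0.
  rewrite ge0_integralD//.
  rewrite integral_cst//= lebesgue_measure_unit_interval mule1 leeD2l//.
  apply: nonneg_le_integral => x /=; rewrite in_itv/= => /andP[x0 x1].
  rewrite !lee_fin sqr_ge0/=; have [->|xy] := eqVneq x y.
    by rewrite !subrr normr0 expr0n/= mul0r.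
  have d0 : 0 < `|x - y| ^+ 2 by rewrite exprn_gt0// normr_gt0 subr_eq0.
  rewrite ler_pdivlMr// ler_piMr ?sqr_ge0// expr_le1// ler_norml.
  by move: yI; rewrite in_itv/= => /andP[? ?]; apply/andP; split; lra.
have C0 : 0 <= C.
  rewrite -lee_fin (le_trans _ wC)// /energy.
  apply: integral_ge0 => z _.
  by apply: integral_ge0 => x _; rewrite lee_fin divr_ge0// sqr_ge0.
have [cM|cM] := leP c (M ^+ 2); first by rewrite (le_trans cM)// lerDl.
rewrite -lerBlDl -lee_fin; apply: le_trans wC.
rewrite -[leLHS]mule1 -lebesgue_measure_unit_interval -integral_cst//.
apply: nonneg_le_integral => y yI; rewrite lee_fin subr_ge0 ltW//=.
by rewrite EFinB leeBlDl// key.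
Qed.

End energy_lower_bound.

(** * Displacements as sums of ramps *)

Section pairing.
Context {R : realType}.
Notation mu := (@lebesgue_measure R).
Implicit Types (a b c l : R) (f g h phi : R -> R).

Lemma pairingB a b f g h : Linfty a b f -> Linfty a b g -> Linfty a b h ->
  \int[mu]_(x in `]a, b[) ((f x - g x) * h x) =
  \int[mu]_(x in `]a, b[) (f x * h x) - \int[mu]_(x in `]a, b[) (g x * h x).
Proof.
move=> Lf Lg Lh; under eq_Rintegral do rewrite mulrBl.
by rewrite RintegralB//; apply: Linfty_integrable; exact: LinftyM.
Qed.

Lemma pairingZ a b c f h : Linfty a b f -> Linfty a b h ->
  \int[mu]_(x in `]a, b[) (c * f x * h x) =
  c * \int[mu]_(x in `]a, b[) (f x * h x).
Proof.
move=> Lf Lh; under eq_Rintegral do rewrite -mulrA.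
by rewrite RintegralZl//; apply: Linfty_integrable; exact: LinftyM.
Qed.

Lemma pairing_sum a b (I : Type) (s : seq I) (F : I -> R -> R) h :
  (forall i, Linfty a b (F i)) -> Linfty a b h ->
  \int[mu]_(x in `]a, b[) ((\sum_(i <- s) F i x) * h x) =
  \sum_(i <- s) \int[mu]_(x in `]a, b[) (F i x * h x).
Proof.
move=> LF Lh; elim: s => [|i s IHs].
  under eq_Rintegral do rewrite big_nil mul0r.
  by rewrite big_nil Rintegral_cst// mul0r.
under eq_Rintegral do rewrite big_cons mulrDl.
rewrite RintegralD//; first by rewrite IHs big_cons.
- by apply: Linfty_integrable; exact: LinftyM.
- by apply: Linfty_integrable; apply: LinftyM => //; exact: Linfty_sum.
Qed.

End pairing.

Section displacement.
Context {R : realType}.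
Notation mu := (@lebesgue_measure R).
Implicit Types (a b c l lambda Lambda delta : R) (f g h phi : R -> R).

(** Its weak derivative is the indicator of the half-line to the right of
    [a], so that displacements are combinations of ramps. *)
Definition ramp a (x : R) : R := Num.max 0 (x - a).

Lemma continuous_ramp a : continuous (ramp a).
Proof.
move=> x; apply: (@continuous_max R R (cst 0) (fun x : R => x - a)).
  exact: cvg_cst.
by apply: cvgB; [exact: cvg_id|exact: cvg_cst].
Qed.

Lemma C1c_continuous a b phi : C1c a b phi -> continuous phi.
Proof.
move=> [dphi _ _] x; apply: differentiable_continuous.
exact/derivable1_diffP.
Qed.

Lemma C1c_out a b phi x : C1c a b phi -> x \notin `]a, b[ -> phi x = 0.
Proof.
move=> [_ _ [_ sub]] xab; apply: contraNeq xab => phix.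
by apply: sub; exact: subset_closure.
Qed.

Lemma Rintegral_oo_cc a b f :
  continuous f ->
  \int[mu]_(x in `]a, b[) f x = \int[mu]_(x in `[a, b]) f x.
Proof.
move=> cf.
have intf : mu.-integrable `[a, b] (EFin \o f).
  have cK := @segment_compact R a b.
  exact: (@continuous_compact_integrable R f _ cK (continuous_subspaceT cf)).
rewrite Rintegral_itv_bndo_bndc ?Rintegral_itv_obnd_cbnd//.
- by apply: integrableS intf => //; apply: subset_itv; rewrite bnd_simp.
- by apply: integrableS intf => //; apply: subset_itv; rewrite bnd_simp.
Qed.

(** Integration by parts on the segment [a, l]: the boundary terms vanish
    since the ramp is 0 at [a] and [phi] is 0 at [l]. *)
Lemma ramp_pairing a l phi : 0 <= a -> a < l -> C1c 0 l phi ->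
  \int[mu]_(x in `]0, l[) (ramp a x * derive1 phi x) =
  - \int[mu]_(x in `]a, l[) phi x.
Proof.
move=> a0 al Cphi; have [dphi cphi' sphi] := Cphi.
have cphi := C1c_continuous Cphi.
transitivity (\int[mu]_(x in `]a, l[) (ramp a x * derive1 phi x)).
  rewrite Rintegral_mkcond [in RHS]Rintegral_mkcond; apply: eq_Rintegral => x _.
  rewrite !patchE; case: ifPn; case: ifPn => //.
    move=> xal; rewrite inE/= in_itv/= => /andP[_ xl].
    rewrite /ramp max_l ?mul0r// subr_le0 leNgt; apply: contra xal => ax.
    by rewrite inE/= in_itv/= ax.
  move=> xal /negP[]; move: xal; rewrite !inE/= !in_itv/= => /andP[ax ->].
  by rewrite (le_lt_trans a0 ax).
rewrite !Rintegral_oo_cc//; last first.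
  by move=> x; apply: cvgM; [exact: continuous_ramp|exact: cphi'].
rewrite (@eq_Rintegral _ _ _ mu _ (fun x => (x - a) * derive1 phi x));
  last first.
  move=> x; rewrite inE/= in_itv/= => /andP[ax _].
  by rewrite /ramp max_r// subr_ge0.
have dsub x : is_derive x (1 : R) (fun x : R => x - a) 1.
  by rewrite -[X in is_derive _ _ _ X]subr0; apply: is_deriveB.
have csub : continuous (fun x : R => x - a).
  by move=> x; apply: cvgB; [exact: cvg_id|exact: cvg_cst].
rewrite (@Rintegration_by_parts _ _ phi (fun=> 1) _ _ _ al).
- rewrite subrr mul0r subr0 (C1c_out Cphi) ?mulr0 ?sub0r; last first.
    by rewrite in_itv/= ltxx andbF.
  by congr (- _); apply: eq_Rintegral => x _; rewrite mul1r.
- by apply: continuous_subspaceT => x; exact: cvg_cst.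
- split.
  + by move=> x _; have [] := dsub x.
  + exact/cvg_at_right_filter/csub.
  + exact/cvg_at_left_filter/csub.
- by move=> x _; rewrite derive1E; exact: derive_val.
- exact: continuous_subspaceT.
- split.
  + by move=> x _; exact: dphi.
  + exact/cvg_at_right_filter/cphi.
  + exact/cvg_at_left_filter/cphi.
- by [].
Qed.

End displacement.

Section slope.
Context {R : realType}.
Notation mu := (@lebesgue_measure R).
Implicit Types (a b l lambda Lambda delta : R) (phi psi : R -> R).
Implicit Types X : {fset R}.

Lemma indic_Linfty a b (A : set R) : measurable A -> Linfty a b (\1_A : R -> R).
Proof.
move=> mA; apply: (bounded_Linfty (M := 1)); first exact: measurable_indic.
by move=> x _; rewrite indicE; case: (x \in A); rewrite ?normr1 ?normr0.
Qed.

Lemma measurable_core delta y : measurable (core delta y : set R).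
Proof. exact: measurable_itv. Qed.

Lemma eq_slope lambda Lambda delta l X :
  {in `]0, l[, slope lambda Lambda delta l X =1
    (fun x => lambda - (Lambda + lambda) * \sum_(y <- X) \1_(core delta y) x)}.
Proof.
by move=> x xl; rewrite /slope indicE mem_set// mul1r.
Qed.

Lemma sum_core_Linfty a b delta X :
  Linfty a b (fun x => \sum_(y <- X) (\1_(core delta y) : R -> R) x).
Proof.
by apply: Linfty_sum => y; exact: indic_Linfty (measurable_core delta y).
Qed.

Lemma slope_Linfty lambda Lambda delta l X :
  Linfty 0 l (slope lambda Lambda delta l X).
Proof.
apply: (LinftyB (cst_Linfty _ _ _)); apply: LinftyZ.
apply: LinftyM; last exact: sum_core_Linfty.
exact: indic_Linfty.
Qed.

(** The cores may stick out of ]0, l[, which is harmless for a function that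
    vanishes there. *)
Lemma slope_pairing lambda Lambda delta l X psi : Linfty 0 l psi ->
  (forall x, x \notin `]0, l[ -> psi x = 0) ->
  \int[mu]_(x in `]0, l[) (slope lambda Lambda delta l X x * psi x) =
  lambda * \int[mu]_(x in `]0, l[) psi x -
  (Lambda + lambda) * \sum_(y <- X) \int[mu]_(x in core delta y) psi x.
Proof.
move=> Lpsi psi0.
transitivity (\int[mu]_(x in `]0, l[)
  ((lambda - (Lambda + lambda) * \sum_(y <- X) \1_(core delta y) x) * psi x)).
  by apply: eq_Rintegral => x /set_mem xl; rewrite eq_slope.
rewrite pairingB//; first last.
- by apply: LinftyZ; exact: sum_core_Linfty.
- exact: cst_Linfty.
rewrite RintegralZl//; last exact: Linfty_integrable.
rewrite pairingZ//; last exact: sum_core_Linfty.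
rewrite pairing_sum//; last first.
  by move=> y; exact: indic_Linfty (measurable_core delta y).
congr (_ - _ * _); apply: eq_bigr => y _.
rewrite Rintegral_mkcond [in RHS]Rintegral_mkcond; apply: eq_Rintegral => x _.
rewrite !patchE indicE.
have [xc|xc] := boolP (x \in core delta y); last by rewrite mul0r; case: ifP.
rewrite mul1r; case: ifPn => // xl; rewrite psi0//.
by apply: contra xl => xl; rewrite inE.
Qed.

End slope.

Section displacement_of_configuration.
Context {R : realType}.
Notation mu := (@lebesgue_measure R).
Implicit Types (a b l lambda Lambda delta : R) (phi psi : R -> R).
Implicit Types X : {fset R}.

Definition displacement_fun lambda Lambda delta X (x : R) : R :=
  lambda * ramp 0 x - (Lambda + lambda) *
    \sum_(y <- X) (ramp (y - delta / 2) x - ramp (y + delta / 2) x).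

Lemma ramp_Linfty a b c : Linfty a b (ramp c : R -> R).
Proof. exact/continuous_Linfty/continuous_ramp. Qed.

(** Turns the difference of the pairings of two ramps, as given by
    [ramp_pairing], into an integral over a core. *)
Lemma Rintegral_oo_split a b l phi : continuous phi -> a <= b -> b < l ->
  \int[mu]_(x in `]a, l[) phi x - \int[mu]_(x in `]b, l[) phi x =
  \int[mu]_(x in `]a, b[) phi x.
Proof.
move=> cphi ab bl.
have iphi := Linfty_integrable (continuous_Linfty a l cphi).
rewrite [RHS]Rintegral_itv_bndo_bndc; last first.
  exact: Linfty_integrable (continuous_Linfty a b cphi).
rewrite -(@Rintegral_itvB _ phi (BRight a) (BLeft l) b)//.
  by rewrite opprB addrC subrK.
Qed.

(** Each core contributes a difference of two ramps, whose slope is the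
    indicator of the core. *)
Lemma displacement_funP lambda Lambda delta l X : 0 < delta ->
  (forall y, y \in X -> 0 <= y - delta / 2 /\ y + delta / 2 < l) -> 0 < l ->
  is_displacement lambda Lambda delta l X
    (displacement_fun lambda Lambda delta X).
Proof.
move=> delta0 Xl l0.
have Lbump (y : R) :
    Linfty 0 l (fun x => ramp (y - delta / 2) x - ramp (y + delta / 2) x).
  by apply: LinftyB; exact: ramp_Linfty.
have Lbumps := Linfty_sum X Lbump.
split.
- by apply: LinftyB; apply: LinftyZ => //; exact: ramp_Linfty.
- exact: slope_Linfty.
move=> phi Cphi; have cphi := C1c_continuous Cphi.
have [_ cphi' _] := Cphi; have Lphi' := continuous_Linfty 0 l cphi'.
rewrite slope_pairing; first last.
- by move=> x; exact: C1c_out.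
- exact: continuous_Linfty.
rewrite pairingB//; [|by apply: LinftyZ => //; exact: ramp_Linfty..].
rewrite !pairingZ//; last exact: ramp_Linfty.
rewrite pairing_sum// ramp_pairing//.
rewrite [X in _ - _ * X](_ : _ =
  - \sum_(y <- X) \int[mu]_(x in core delta y) phi x); first by ring.
rewrite -sumrN big_seq [RHS]big_seq; apply: eq_bigr => y /Xl[y0 yl].
rewrite pairingB//; [|exact: ramp_Linfty..].
rewrite !ramp_pairing//; [|lra..].
rewrite /core -(Rintegral_oo_split cphi _ yl); first lra.
lra.
Qed.

End displacement_of_configuration.

(** * A periodic configuration of bounded energy *)

Section staircase.
Context {R : realType}.
Implicit Types (a p delta lambda K x y : R).

Definition tread delta a x : R := ramp a x - ramp (a + delta) x.

(** The total length of the periodic cores to the left of [x]. *)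
Definition staircase p delta N x : R :=
  \sum_(i < N) tread delta (i%:R * p) x.

Lemma tread_left delta a x : 0 <= delta -> x <= a -> tread delta a x = 0.
Proof. by move=> d0 xa; rewrite /tread /ramp !max_l ?subrr//; lra. Qed.

Lemma tread_right delta a x : 0 <= delta -> a + delta <= x ->
  tread delta a x = delta.
Proof. by move=> d0 xa; rewrite /tread /ramp !max_r; lra. Qed.

Lemma tread_lipschitz delta a x y : 0 <= delta -> y <= x ->
  0 <= tread delta a x - tread delta a y <= x - y.
Proof.
move=> d0 yx; rewrite /tread /ramp /Order.max.
do 4 case: ifPn; rewrite -?leNgt => ? ? ? ?; apply/andP; split; lra.
Qed.

Lemma staircase_left p delta N x : 0 <= p -> 0 <= delta -> x <= 0 ->
  staircase p delta N x = 0.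
Proof.
move=> p0 d0 x0; apply: big1 => i _; apply: tread_left => //.
by rewrite (le_trans x0)// mulr_ge0.
Qed.

(** Peeling off the first period shifts the staircase, so the estimates below
    go by induction on the number of periods. *)
Lemma staircaseS p delta N x :
  staircase p delta N.+1 x = tread delta 0 x + staircase p delta N (x - p).
Proof.
rewrite /staircase big_ord_recl mul0r; congr (_ + _); apply: eq_bigr => i _.
rewrite /tread /ramp /= /bump/= add1n -natr1.
by congr (Num.max _ _ - Num.max _ _); ring.
Qed.

(** The rising intervals of the treads do not overlap, because
    [delta <= p]. *)
Lemma staircase_lipschitz p delta N x y : 0 <= delta -> delta <= p -> y <= x ->
  0 <= staircase p delta N x - staircase p delta N y <= x - y.
Proof.
move=> d0 dp; have p0 := le_trans d0 dp.
elim: N x y => [|N IH] x y yx; first by rewrite /staircase !big_ord0; lra.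
rewrite !staircaseS; have b := @tread_lipschitz delta 0.
have [xp|px] := leP x p.
  by rewrite !staircase_left ?addr0 ?b//; lra.
have [yp|py] := leP y p.
  have := IH (x - p) 0 ltac:(lra); rewrite [X in _ - X]staircase_left// => IHx.
  rewrite [X in _ - (_ + X)]staircase_left//; last lra.
  have := b p y d0 yp.
  rewrite (@tread_right _ _ x) ?(@tread_right _ _ p)//; lra.
rewrite !(@tread_right _ 0)//; [|lra..].
have := IH (x - p) (y - p) ltac:(lra); lra.
Qed.

(** When [lambda * p = K * delta] the function
    [lambda * x - K * staircase x] returns to 0 after each period, so it never
    exceeds its oscillation on one period. *)
Lemma staircase_drift p delta lambda K N x : 0 <= delta -> delta <= p ->
  0 <= lambda -> 0 <= K -> lambda * p = K * delta -> 0 <= x <= N.+1%:R * p ->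
  `|lambda * x - K * staircase p delta N x| <= lambda * p.
Proof.
move=> d0 dp lambda0 K0 pE; have p0 := le_trans d0 dp.
elim: N x => [|N IH] x /andP[x0 xN].
  rewrite /staircase big_ord0 mulr0 subr0 ger0_norm ?mulr_ge0//.
  by rewrite ler_wpM2l// -[leRHS]mul1r.
rewrite staircaseS; have [xp|px] := leP x p.
  rewrite staircase_left//; last lra.
  rewrite addr0.
  have := @tread_lipschitz delta 0 x 0 d0 x0.
  rewrite (@tread_left _ 0 0)// subr0 => /andP[b0 _].
  have bd : tread delta 0 x <= delta.
    have [xd|dx] := leP x delta; last by rewrite tread_right//; lra.
    have := @tread_lipschitz delta 0 delta x d0 xd.
    by rewrite tread_right//; lra.
  have Kb0 : 0 <= K * tread delta 0 x by rewrite mulr_ge0.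
  have Kb : K * tread delta 0 x <= lambda * p by rewrite pE ler_wpM2l.
  have lx0 : 0 <= lambda * x by rewrite mulr_ge0.
  have lx : lambda * x <= lambda * p by rewrite ler_wpM2l.
  by rewrite ler_norml; apply/andP; split; lra.
have -> : lambda * x - K * (tread delta 0 x + staircase p delta N (x - p)) =
    lambda * (x - p) - K * staircase p delta N (x - p).
  by rewrite tread_right//; lra.
apply: IH; apply/andP; split; first lra.
by move: xN; rewrite -[N.+2%:R]natr1; lra.
Qed.

End staircase.

Section periodic_configuration.
Context {R : realType}.
Implicit Types (a p delta lambda Lambda K l x y : R).

Definition periodic_configuration p delta N : {fset R} :=
  [fset x in [seq (i%:R * p + delta / 2)%R | i <- iota 0 N]]%fset.

Lemma big_periodic_configuration p delta N (F : R -> R) : 0 < p ->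
  \sum_(y <- periodic_configuration p delta N) F y =
  \sum_(i < N) F (i%:R * p + delta / 2).
Proof.
move=> p0; rewrite -(big_mkord xpredT (fun i => F (i%:R * p + delta / 2))).
rewrite /index_iota subn0.
rewrite -(big_map (fun i : nat => i%:R * p + delta / 2) xpredT).
apply: perm_big; apply: uniq_perm.
- exact: fset_uniq.
- rewrite map_inj_uniq ?iota_uniq// => i j /addIr /(mulIf (lt0r_neq0 p0)).
  by move=> /eqP; rewrite eqr_nat => /eqP.
- by move=> y; rewrite inE.
Qed.

Lemma periodic_configurationP p delta N y :
  y \in periodic_configuration p delta N ->
  exists2 i, (i < N)%N & y = i%:R * p + delta / 2.
Proof.
rewrite inE => /mapP[i]; rewrite mem_iota add0n => /andP[_ iN] ->.
by exists i.
Qed.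

(** The cores are the intervals ](i p), (i p + delta)[. *)
Lemma periodic_cores p delta N l y : 0 <= delta -> delta < p ->
  N%:R * p <= l -> y \in periodic_configuration p delta N ->
  0 <= y - delta / 2 /\ y + delta / 2 < l.
Proof.
move=> d0 dp Nl /periodic_configurationP[i iN ->].
have p0 : 0 < p := le_lt_trans d0 dp.
rewrite addrK; split; first by rewrite mulr_ge0// ltW.
apply: lt_le_trans Nl; apply: (@lt_le_trans _ _ (i.+1%:R * p)).
  by rewrite -[i.+1%:R]natr1; lra.
by rewrite ler_wpM2r ?ler_nat// ltW.
Qed.

Lemma periodic_configuration_AD p delta N l : 0 < delta -> delta < p ->
  N%:R * p <= l -> AD delta l (periodic_configuration p delta N).
Proof.
move=> d0 dp Nl; have p0 : 0 < p := lt_trans d0 dp; split.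
  move=> y /(periodic_cores (ltW d0) dp Nl)[y0 yl].
    have y1 : - (delta / 2) < y by lra.
    have y2 : y < l + delta / 2 by lra.
    by rewrite y1 y2.
apply/trivIsetP => y1 y2 /periodic_configurationP[i _ ->].
move=> /periodic_configurationP[j _ ->] ij {y1 y2}.
(* By symmetry the core of index [i] lies to the left. *)
wlog ltij : i j ij / (i < j)%N.
  move=> W; case: (ltngtP i j) => h; first exact: W.
    by rewrite setIC; apply: W => //; rewrite eq_sym.
  by rewrite h eqxx in ij.
apply/seteqP; split=> // x [] /=; rewrite /core/= !in_itv/=.
move=> /andP[_ xi] /andP[xj _].
have : i.+1%:R * p <= j%:R * p by rewrite ler_wpM2r ?ler_nat// ltW.
by rewrite -[i.+1%:R]natr1; lra.
Qed.

Lemma displacement_fun_periodic lambda Lambda p delta N x : 0 < p -> 0 <= x ->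
  displacement_fun lambda Lambda delta (periodic_configuration p delta N) x =
  lambda * x - (Lambda + lambda) * staircase p delta N x.
Proof.
move=> p0 x0; rewrite /displacement_fun big_periodic_configuration//.
rewrite [ramp 0 x]max_r ?subr0//; congr (_ - _ * _); apply: eq_bigr => i _.
by rewrite /tread; congr (ramp _ _ - ramp _ _); lra.
Qed.

End periodic_configuration.

Section energy_upper_bound.
Context {R : realType}.
Notation mu := (@lebesgue_measure R).

Lemma continuous_lorentzian (l y : R) :
  continuous (fun x : R => l / (1 + (l * (x - y)) ^+ 2)).
Proof.
have clin : continuous (fun x : R => l * (x - y)).
  move=> x; apply: cvgMl_tmp; apply: cvgB; [exact: cvg_id|exact: cvg_cst].
have cden : continuous (fun x : R => 1 + (l * (x - y)) ^+ 2).
  move=> x; apply: cvgD; first exact: cvg_cst.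
  by apply: cvgM; exact: clin.
move=> x; apply: cvgMl_tmp; apply: cvgV; last exact: cden.
by rewrite gt_eqF// ltr_pwDl// sqr_ge0.
Qed.

Lemma lorentzian_ge0 (l y x : R) : 0 < l ->
  0 <= l / (1 + (l * (x - y)) ^+ 2).
Proof. by move=> l0; rewrite divr_ge0// ?(ltW l0)// addr_ge0// sqr_ge0. Qed.

(** The antiderivative is [atan (l * (x - y))], whose total variation is at
    most [pi]. *)
Lemma integral_lorentzian (l y : R) : 0 < l ->
  (\int[mu]_(x in `]0%R, 1%R[) (l / (1 + (l * (x - y)) ^+ 2))%:E <= pi%:E)%E.
Proof.
move=> l0.
have dlin x : is_derive x (1 : R) (fun x => l * (x - y)) l.
  rewrite -[X in is_derive _ _ _ X]mulr1.
  apply: (@is_deriveZ _ _ _ (fun x => x - y)).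
  by rewrite -[X in is_derive _ _ _ X]subr0; apply: is_deriveB.
have datan x : is_derive x (1 : R) (fun x => atan (l * (x - y)))
    (l / (1 + (l * (x - y)) ^+ 2)).
  have da : is_derive (l * (x - y)) (1 : R) (@atan R)
      (1 + (l * (x - y)) ^+ 2)^-1.
    by apply: DeriveDef; [exact: derivable_atan|rewrite -derive1E derive1_atan].
  have := @is_derive1_comp R (@atan R) _ x _ _ da (dlin x).
  by rewrite mulrC.
have catan : continuous (fun x : R => atan (l * (x - y))).
  move=> x; apply: differentiable_continuous; apply/derivable1_diffP.
  by have [] := datan x.
apply: (@le_trans _ _ (\int[mu]_(x in `[0%R, 1%R])
    (l / (1 + (l * (x - y)) ^+ 2))%:E)%E).
  rewrite integral_mkcond [leRHS]integral_mkcond; apply: nonneg_le_integral.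
  move=> x _; rewrite !patchE.
  have k0 : (0 <= (l / (1 + (l * (x - y)) ^+ 2))%:E)%E.
    by rewrite lee_fin lorentzian_ge0.
  case: ifPn => [|_]; last by rewrite lexx/=; case: ifP.
  move=> xI; rewrite k0/= ifT// inE; apply: subset_itv_oo_cc.
  exact: set_mem xI.
rewrite (@continuous_FTC2 _ _ (fun x => atan (l * (x - y))))//.
- rewrite -EFinB lee_fin.
  have := atan_ltpi2 (l * (1 - y)); have := atan_gtNpi2 (l * (0 - y)); lra.
- exact/continuous_subspaceT/continuous_lorentzian.
- split.
  + by move=> x _; have [] := datan x.
  + exact/cvg_at_right_filter/catan.
  + exact/cvg_at_left_filter/catan.
- by move=> x _; rewrite derive1E; exact: derive_val.
Qed.

(** With [s = l * |x - y|], the increment of [u] satisfies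
    [|u (l x) - u (l y)|^2 (1 + s^2) <= (K^2 + B^2) s^2]: the Lipschitz bound
    handles the term 1 and the bound on the oscillation the term [s^2].  The
    integrand of the energy is thus at most [K^2 + B^2] times a Lorentzian
    whose integral does not depend on [l]. *)
Lemma energy_le (K B l : R) (u : R -> R) : 0 < l ->
  (forall x y, x \in `]0, l[ -> y \in `]0, l[ ->
    `|u x - u y| <= B /\ `|u x - u y| <= K * `|x - y|) ->
  (energy (rescale l u) <= ((K ^+ 2 + B ^+ 2) * pi)%:E)%E.
Proof.
move=> l0 uL; pose M := K ^+ 2 + B ^+ 2.
have M0 : 0 <= M by rewrite addr_ge0 ?sqr_ge0.
have mI : measurable (`]0, 1[ : set (measurableTypeR R)) by [].
have sqrtl0 : 0 < Num.sqrt l by rewrite sqrtr_gt0.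
have inner y : y \in `]0, 1[ -> (\int[mu]_(x in `]0%R, 1%R[)
    (`|rescale l u x - rescale l u y| ^+ 2 / `|x - y| ^+ 2)%:E <=
    (M * pi)%:E)%E.
  move=> yI.
  have yl : l * y \in `]0, l[ by exact: dilation_itv.
  apply: (@le_trans _ _ (\int[mu]_(x in `]0%R, 1%R[)
      (M%:E * (l / (1 + (l * (x - y)) ^+ 2))%:E))%E).
    apply: nonneg_le_integral => x /= xI; rewrite -EFinM !lee_fin.
    apply/andP; split; first by rewrite divr_ge0// sqr_ge0.
    have [->|xy] := eqVneq x y.
      rewrite !subrr normr0 expr0n/= mul0r mulr0 expr0n/= addr0.
      by rewrite divr1 mulr_ge0// ltW.
    have xl : l * x \in `]0, l[ by exact: dilation_itv.
    have [uB uK] := uL _ _ xl yl.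
    rewrite /rescale -mulrBl normrM normfV (gtr0_norm sqrtl0) expr_div_n.
    rewrite sqr_sqrtr ?(ltW l0)//.
    have d0 : 0 < `|x - y| by rewrite normr_gt0 subr_eq0.
    rewrite -mulrBr normrM (gtr0_norm l0) in uK.
    rewrite exprMn -(real_normK (num_real (x - y))).
    move: `|x - y| `|u (l * x) - u (l * y)| (normr_ge0 (u (l * x) - u (l * y)))
      d0 uB uK => s t t0 s0 tB tK.
    have ls0 : 0 <= l ^+ 2 * s ^+ 2 by rewrite mulr_ge0 ?sqr_ge0.
    rewrite mulrA ler_pdivlMr; last lra.
    rewrite mulrAC ler_pdivrMr ?exprn_gt0// mulrAC ler_pdivrMr//.
    have tB2 := ler_pM t0 t0 tB tB; have tK2 := ler_pM t0 t0 tK tK.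
    have tBls := ler_wpM2r ls0 tB2.
    by move: ls0 tB2 tK2 tBls; rewrite /M !expr2; lra.
  have mk : measurable_fun (`]0, 1[ : set R)
      (fun x => (l / (1 + (l * (x - y)) ^+ 2))%:E).
    apply/measurable_EFinP.
    apply: measurable_funTS (continuous_measurable_fun _).
    exact: continuous_lorentzian.
  have k0 x : (0 <= (l / (1 + (l * (x - y)) ^+ 2))%:E)%E.
    by rewrite lee_fin lorentzian_ge0.
  rewrite ge0_integralZl_EFin//.
  by rewrite EFinM lee_wpmul2l// integral_lorentzian.
apply: (@le_trans _ _ (\int[mu]_(y in `]0%R, 1%R[) (M * pi)%:E)%E).
  apply: nonneg_le_integral => y /= yI; rewrite inner// andbT.
  by apply: integral_ge0 => x _; rewrite lee_fin divr_ge0// sqr_ge0.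
by rewrite integral_cst//= lebesgue_measure_unit_interval mule1.
Qed.

End energy_upper_bound.

(** * Measures of configurations *)

Section measures_of_configurations.
Context {R : realType}.
Notation mu := (@lebesgue_measure R).
Implicit Types (delta l : R) (X : {fset R}).

Lemma Rintegral_msum_dirac d (T : measurableType d) (a : nat -> T) N
    (D : set T) (f : T -> R) :
  measurable D -> measurable_fun D f -> (forall x, ~ D x -> f x = 0) ->
  \int[msum (fun i => dirac (a i) : {measure set T -> \bar R}) N]_(x in D) f x =
  \sum_(i < N) f (a i).
Proof.
move=> mD mf f0.
have mEf : measurable_fun D (EFin \o f) by exact/measurable_EFinP.
pose m : {measure set T -> \bar R} :=
  msum (fun i => dirac (a i) : {measure set T -> \bar R}) N.
have sumD (g : T -> R) : measurable_fun D (EFin \o g) -> (forall x, 0 <= g x) ->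
    (forall x, ~ D x -> g x = 0) ->
    (\int[m]_(x in D) (g x)%:E =
    (\sum_(i < N) g (a i))%:E)%E.
  move=> mg g0 gD; rewrite ge0_integral_measure_sum//; last first.
    by move=> x _; rewrite lee_fin.
  rewrite -sumEFin; apply: eq_bigr => i _; rewrite integral_dirac// diracE.
  have [_|/negP aD] := boolP (a i \in D); first by rewrite mul1e.
  by rewrite mul0e gD// => /mem_set.
rewrite -[LHS]/(\int[m]_(x in D) f x) /Rintegral integralE.
under eq_integral do rewrite funeposE -EFin_max.
under [X in (_ - X)%E]eq_integral do rewrite funenegE -EFin_max.
rewrite (sumD (fun x => Num.max (f x) 0)); first last.
- by move=> x /f0 ->; rewrite maxxx.
- by move=> x; rewrite le_max lexx orbT.
- by apply/measurable_EFinP; exact: measurable_maxr.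
rewrite (sumD (fun x => Num.max (- f x) 0)); first last.
- by move=> x /f0 ->; rewrite oppr0 maxxx.
- by move=> x; rewrite le_max lexx orbT.
- apply/measurable_EFinP; apply: measurable_maxr => //.
  exact: measurableT_comp.
rewrite -EFinB/= -sumrB; apply: eq_bigr => i _.
by rewrite /Order.max; do 2 case: ifPn; rewrite -?leNgt => ? ?; lra.
Qed.

Lemma Rintegral_dislocation_measure l X (phi : R -> R) : 0 < l ->
  continuous phi -> (forall x, x \notin `]0, 1[ -> phi x = 0) ->
  \int[dislocation_measure l X]_(x in `]0, 1[) phi x =
  l^-1 * \sum_(y <- X) phi (y / l).
Proof.
move=> l0 cphi phi0.
have mI : measurable (`]0, 1[ : set (measurableTypeR R)) by [].
have mphi : measurable_fun (`]0, 1[ : set (measurableTypeR R)) phi.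
  exact: measurable_funTS (continuous_measurable_fun cphi).
rewrite /dislocation_measure Rintegral_mscale//= gtr0_norm ?invr_gt0//.
rewrite Rintegral_msum_dirac//; last by move=> x xI; apply: phi0; apply/negP.
by congr (_ * _); rewrite (big_nth 0) big_mkord.
Qed.

(** The cores are disjoint and contained in ](- delta), (l + delta)[. *)
Lemma card_AD delta l X : 0 < delta -> 0 < l -> AD delta l X ->
  (#|` X|)%:R * delta <= l + 2 * delta.
Proof.
move=> d0 l0 [Xl tX].
have mcore y : measurable (core delta y : set (measurableTypeR R)).
  exact: measurable_core.
have sub : \bigcup_(y in [set` X]) core delta y `<=` `]- delta, l + delta[.
  move=> x [y /= /Xl /andP[y1 y2]]; rewrite /core/= !in_itv/= => /andP[x1 x2].
  by apply/andP; split; lra.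
have mcoreE y : mu (core delta y) = delta%:E.
  rewrite lebesgue_measure_itv/= lte_fin ifT; last lra.
  by rewrite -EFinB; congr EFin; lra.
have : (mu (\bigcup_(y in [set` X]) core delta y) <=
    mu (`](- delta)%R, (l + delta)%R[%classic : set R))%E.
  apply: le_measure => //; rewrite inE.
    exact: fin_bigcup_measurable.
  exact: measurable_itv.
rewrite measure_fin_bigcup//= lebesgue_measure_itv/= lte_fin ifT; last lra.
rewrite -(fsbig_seq _ _ (fset_uniq X)).
under eq_bigr do rewrite mcoreE.
rewrite sumEFin -EFinB lee_fin big_const_seq count_predT iter_addr addr0.
by rewrite -mulr_natl; lra.
Qed.

End measures_of_configurations.

(** * Minimizers and equidistribution *)

Section minimizers.
Context {R : realType}.
Notation mu := (@lebesgue_measure R).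
Implicit Types (delta l lambda Lambda M C : R) (X : {fset R}) (g u w : R -> R).

(** The period [p] is chosen so that the rise [lambda * p] over a period is
    compensated by the drop [(Lambda + lambda) * delta] across its core. *)
Lemma bounded_energy_competitor lambda Lambda delta :
  0 < lambda -> 0 < Lambda -> 0 < delta ->
  exists C, forall l, 0 < l ->
    exists2 v, rescaled_displacements lambda Lambda delta l v &
               (energy v <= C%:E)%E.
Proof.
move=> lambda0 Lambda0 d0; pose p := delta * (Lambda + lambda) / lambda.
have pE : lambda * p = (Lambda + lambda) * delta.
  by rewrite /p; field; rewrite gt_eqF.
have dp : delta < p.
  by rewrite -(ltr_pM2l lambda0) pE mulrDl [lambda * _]mulrC; nra.
have p0 : 0 < p := lt_trans d0 dp.
exists (((Lambda + lambda) ^+ 2 + (2 * (lambda * p)) ^+ 2) * pi) => l l0.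
(* As many whole periods as fit; less than one period is left over. *)
pose N := Num.truncn (l / p).
have /andP[Nl lN] : N%:R * p <= l <= N.+1%:R * p.
  have /andP[N1 N2] : N%:R <= l / p < N.+1%:R.
    by apply: truncn_itv; rewrite divr_ge0// ltW.
  by rewrite -ler_pdivlMr// N1/= -ler_pdivrMr// ltW.
pose X := periodic_configuration p delta N.
pose u := displacement_fun lambda Lambda delta X.
have uE x : 0 <= x ->
    u x = lambda * x - (Lambda + lambda) * staircase p delta N x.
  exact: displacement_fun_periodic.
exists (rescale l u).
  exists u => //; exists X; first exact: periodic_configuration_AD.
  by apply: displacement_funP => // y; apply: periodic_cores => //; exact: ltW.
apply: energy_le => // x y; rewrite !in_itv/= => /andP[x0 xl] /andP[y0 yl].
rewrite (uE x (ltW x0)) (uE y (ltW y0)); split.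
  have ub z : 0 < z -> z < l ->
      `|lambda * z - (Lambda + lambda) * staircase p delta N z| <= lambda * p.
    move=> z0 zl.
    apply: (staircase_drift (ltW d0) (ltW dp) (ltW lambda0)) => //.
      by rewrite addr_ge0// ltW.
    by rewrite (ltW z0)/= (le_trans (ltW zl)).
  have ux := ub x x0 xl; have uy := ub y y0 yl.
  apply: (le_trans (ler_normB _ _)); lra.
wlog yx : x y x0 xl y0 yl / y <= x => [W|].
  have [yx|xy] := leP y x; first exact: W.
  by rewrite distrC (distrC x); apply: W => //; exact: ltW.
have := @staircase_lipschitz R p delta N x y (ltW d0) (ltW dp) yx.
move=> /andP[s0 s1]; rewrite (ger0_norm (x := x - y)) ?subr_ge0//.
have Ks0 : 0 <=
    (Lambda + lambda) * (staircase p delta N x - staircase p delta N y).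
  by rewrite mulr_ge0// addr_ge0// ltW.
have Ks1 :
    (Lambda + lambda) * (staircase p delta N x - staircase p delta N y) <=
    (Lambda + lambda) * (x - y).
  by rewrite ler_wpM2l// addr_ge0// ltW.
have l1 : 0 <= lambda * (x - y) by rewrite mulr_ge0 ?subr_ge0// ltW.
have l2 : 0 <= Lambda * (x - y) by rewrite mulr_ge0 ?subr_ge0// ltW.
by rewrite ler_norml; apply/andP; split; lra.
Qed.

Lemma eq_energy w1 w2 : {in `]0, 1[, w1 =1 w2} -> energy w1 = energy w2.
Proof.
move=> w12; apply: eq_integral => y /set_mem yI.
by apply: eq_integral => x /set_mem xI; rewrite !w12.
Qed.

(** The weak formulation is tested with [x |-> g (x / l)], and the pairing of
    the displacement with its derivative is bounded by the energy, the factor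
    [sqrt l] coming from the normalization in [rescale]. *)
Lemma slope_defect lambda Lambda delta l X u g M C : 0 < l ->
  is_displacement lambda Lambda delta l X u ->
  (energy (rescale l u) <= C%:E)%E ->
  C1c 0 1 g -> (forall x, x \in `]0, 1[ -> `|derive1 g x| <= M) ->
  `|(Lambda + lambda) *
      (\sum_(y <- X) \int[mu]_(x in core delta y) g (x / l)) -
    lambda * (l * \int[mu]_(x in `]0, 1[) g x)| <=
  Num.sqrt l * (M ^+ 2 + C).
Proof.
move=> l0 [Lu _ wu] uC Cg gM; pose psi x := g (x / l).
have [dg cg' _] := Cg; have cg := C1c_continuous Cg.
have Cpsi : C1c 0 l psi := C1c_dilation l0 Cg.
have cpsi := C1c_continuous Cpsi; have [_ cpsi' _] := Cpsi.
have ll x : l * x / l = x by rewrite mulrC mulKf// gt_eqF.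
have psi'E x : derive1 psi x = derive1 g (x / l) / l.
  rewrite derive1E; have d := derive1_dilation (dg (x / l)).
  exact: derive_val.
have g'0 : \int[mu]_(x in `]0, 1[) derive1 g x = 0.
  rewrite (Rintegral_oo_cc _ _ cg') /Rintegral.
  rewrite (@continuous_FTC2 _ _ g _ _ ltr01).
  - have -> : g 1 = 0 by apply: (C1c_out Cg); rewrite in_itv/= ltxx andbF.
    have -> : g 0 = 0 by apply: (C1c_out Cg); rewrite in_itv/= ltxx.
    by rewrite subee.
  - exact: continuous_subspaceT.
  - split; [by move=> x _; exact: dg|exact/cvg_at_right_filter/cg|
            exact/cvg_at_left_filter/cg].
  - by [].
have Lw : Linfty 0 1 (rescale l u).
  have := LinftyM (Linfty_dilation l0 Lu) (cst_Linfty 0 1 (Num.sqrt l)^-1).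
  exact.
have mg' : measurable_fun (`]0, 1[ : set R) (derive1 g).
  exact: measurable_funTS (continuous_measurable_fun cg').
have sl0 : 0 < Num.sqrt l by rewrite sqrtr_gt0.
have sl : Num.sqrt l * Num.sqrt l = l by rewrite -expr2 sqr_sqrtr// ltW.
have upsiE : \int[mu]_(x in `]0, l[) (u x * derive1 psi x) =
    Num.sqrt l * \int[mu]_(x in `]0, 1[) (rescale l u x * derive1 g x).
  have Lupsi := LinftyM Lu (continuous_Linfty 0 l cpsi').
  rewrite (Rintegral_dilation l0 (Linfty_integrable Lupsi)).
  rewrite -{1}sl -mulrA; congr (_ * _); rewrite -RintegralZl//; last first.
    apply: Linfty_integrable; apply: LinftyM; first exact: Linfty_dilation.
    apply/continuous_Linfty => x; apply: (@continuous_comp R R R ( *%R l)).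
      exact: mulrl_continuous.
    exact: cpsi'.
  apply: eq_Rintegral => x _; rewrite /= psi'E ll /rescale.
  have sV : Num.sqrt l / l = (Num.sqrt l)^-1.
    by rewrite -{2}sl invfM mulrA mulfV ?mul1r// gt_eqF.
  by rewrite -sV; ring.
have weak := wu psi Cpsi.
rewrite upsiE slope_pairing in weak; first last.
- by move=> x; exact: C1c_out.
- exact: continuous_Linfty.
have psiE : \int[mu]_(x in `]0, l[) psi x = l * \int[mu]_(x in `]0, 1[) g x.
  have Lpsi := continuous_Linfty 0 l cpsi.
  rewrite (Rintegral_dilation l0 (Linfty_integrable Lpsi)).
  by congr (_ * _); apply: eq_Rintegral => x _; rewrite /psi ll.
rewrite psiE opprB in weak; rewrite -weak normrM (gtr0_norm sl0) ler_pM2l//.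
exact: energy_bounds_pairing gM g'0 uC.
Qed.

End minimizers.

Section equidistribution.
Context {R : realType}.
Notation mu := (@lebesgue_measure R).
Implicit Types (delta l e : R) (X : {fset R}) (g phi : R -> R).

Lemma Rintegral_near_cst (a b c e : R) (f : R -> R) : a < b -> continuous f ->
  (forall x, x \in `]a, b[ -> `|f x - c| <= e) ->
  `|\int[mu]_(x in `]a, b[) f x - (b - a) * c| <= (b - a) * e.
Proof.
move=> ab cf fc.
have mI : measurable (`]a, b[ : set (measurableTypeR R)) by [].
have muI : fine (mu (`]a, b[ : set R)) = b - a.
  by rewrite lebesgue_measure_itv/= lte_fin ab.
have Lf := continuous_Linfty a b cf; have Lc := cst_Linfty a b c.
have Lfc := LinftyB Lf Lc.
have -> : \int[mu]_(x in `]a, b[) f x - (b - a) * c =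
    \int[mu]_(x in `]a, b[) (f x - c).
  rewrite (RintegralB mI (Linfty_integrable Lf) (Linfty_integrable Lc)).
  by rewrite Rintegral_cst// muI mulrC.
apply: le_trans (le_normr_Rintegral mI (Linfty_integrable Lfc)) _.
rewrite -muI mulrC -Rintegral_cst//.
apply: le_Rintegral => //.
- exact: (integrable_norm (Linfty_integrable Lfc)).
- exact: Linfty_integrable (cst_Linfty a b e).
Qed.

Lemma core_averages delta l X phi psi e : 0 < delta -> 0 < l ->
  2 * delta <= l -> AD delta l X -> continuous psi -> 0 <= e ->
  (forall y x, x \in core delta y -> `|psi x - phi (y / l)| <= e) ->
  `|\sum_(y <- X) \int[mu]_(x in core delta y) psi x -
    delta * \sum_(y <- X) phi (y / l)| <= 2 * l * e.
Proof.
move=> d0 l0 dl ADX cpsi e0 near.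
rewrite big_distrr/= -sumrB; apply: le_trans (ler_norm_sum _ _ _) _.
apply: (@le_trans _ _ (\sum_(y <- X) delta * e)).
  apply: ler_sum => y _.
  have deltaE : (y + delta / 2) - (y - delta / 2) = delta by lra.
  rewrite -{2 3}deltaE /core; apply: Rintegral_near_cst => //; first lra.
  by move=> x xI; apply: near; rewrite inE.
rewrite big_const_seq count_predT iter_addr addr0 -[leLHS]mulr_natl mulrA.
rewrite ler_wpM2r// (le_trans (card_AD d0 l0 ADX))//; lra.
Qed.

End equidistribution.

Theorem theorem2p6 (R : realType) (lambda Lambda delta : {posnum R})
    (hLambda : lambda%:num <= Lambda%:num)
    (w : R -> R -> R) (X : R -> {fset R})
    (hw : forall l : R, 0 < l ->
      energy_minimizer lambda%:num Lambda%:num delta%:num l (w l))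
    (hX : forall l : R, 0 < l ->
      AD delta%:num l (X l) /\
      exists u : R -> R,
        is_displacement lambda%:num Lambda%:num delta%:num l (X l) u /\
        {in `]0, 1[, w l =1 rescale l u}) :
  weak_star_cvg (fun l => dislocation_measure l (X l))
    (mscale (lambda%:num / (delta%:num * (Lambda%:num + lambda%:num)))%:nng
       (@lebesgue_measure R)).
Proof.
move=> phi cphi sphi.
have phi_out x : x \notin `]0, 1[ -> phi x = 0.
  move=> xI; apply: contraNeq xI => phix; have [_ sub] := sphi.
  by apply: sub; exact: subset_closure.
have mphi : measurable_fun (`]0, 1[ : set (measurableTypeR R)) phi.
  exact: measurable_funTS (continuous_measurable_fun cphi).
rewrite Rintegral_mscale//=.
have lam0 : 0 < lambda%:num by [].
have Lam0 : 0 < Lambda%:num by [].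
have d0 : 0 < delta%:num by [].
set lam := lambda%:num in hw hX lam0 *.
set Lam := Lambda%:num in hw hX Lam0 *.
set d := delta%:num in hw hX d0 *.
have K0 : 0 < Lam + lam by rewrite addr_gt0.
have [C energyC] := bounded_energy_competitor lam0 Lam0 d0.
apply/cvgrPdist_le => e e0.
(* The errors, in units of [r (Lam + lam) l]: 4 for replacing core integrals
   by point values, 1 for the defect, 1 for replacing [g] by [phi]. *)
pose r := e * d / 6.
have r0 : 0 < r by rewrite divr_gt0// mulr_gt0.
have [g Cg gphi] := C1c_dense cphi sphi r0.
have [_ cg' _] := Cg; have [M gM] := continuous_bounded_oo 0 1 cg'.
have [eta eta0 phi_eta] := compact_support_unif_cont cphi sphi r0.
(* Once [D <= sqrt l], the defect is at most [r (Lam + lam) l]. *)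
pose D := (M ^+ 2 + C) / (r * (Lam + lam)).
near=> l.
have l0 : 0 < l by near: l; apply: nbhs_pinfty_gt; exact: num_real.
have dl : 2 * d <= l by near: l; apply: nbhs_pinfty_ge; exact: num_real.
have deta : d / eta < l by near: l; apply: nbhs_pinfty_gt; exact: num_real.
have Dl : D ^+ 2 <= l by near: l; apply: nbhs_pinfty_ge; exact: num_real.
have [ADX [u [uX wu]]] := hX l l0.
have uC : (energy (rescale l u) <= C%:E)%E.
  have [v vW vC] := energyC l l0; have [_ wmin] := hw l l0.
  by rewrite -(eq_energy wu) (le_trans (wmin v vW)).
rewrite Rintegral_dislocation_measure//.
have cg := C1c_continuous Cg.
have defect := slope_defect l0 uX uC Cg gM.
have cpsi := C1c_continuous (C1c_dilation l0 Cg).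
have averages :
  `|\sum_(y <- X l) \int[lebesgue_measure]_(x in core d y) g (x / l) -
    d * \sum_(y <- X l) phi (y / l)| <= 2 * l * (2 * r).
  apply: core_averages => //; first by rewrite mulr_ge0// ltW.
  move=> y x; rewrite inE /core/= in_itv/= => /andP[x1 x2].
  have -> : 2 * r = r + r by lra.
  rewrite (le_trans (ler_distD (phi (x / l)) _ _))// lerD//.
  apply: phi_eta; rewrite -mulrBl normrM normfV (gtr0_norm l0).
  rewrite ltr_pdivrMr// mulrC -ltr_pdivrMr//; apply: le_lt_trans deta.
  rewrite ler_pM2r ?invr_gt0// ler_norml; apply/andP; split; lra.
have gI : `|\int[lebesgue_measure]_(x in `]0, 1[) g x -
    \int[lebesgue_measure]_(x in `]0, 1[) phi x| <= r.
  have cgphi : continuous (fun x => g x - phi x).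
    by move=> x; apply: cvgB; [exact: cg|exact: cphi].
  have := Rintegral_near_cst (c := 0) (e := r) ltr01 cgphi.
  rewrite subr0 mulr0 subr0 mul1r RintegralB//.
  - by apply => x _; rewrite subr0.
  - exact/Linfty_integrable/continuous_Linfty.
  - exact/Linfty_integrable/continuous_Linfty.
have sl : Num.sqrt l ^+ 2 = l by rewrite sqr_sqrtr// ltW.
have small : Num.sqrt l * (M ^+ 2 + C) <= r * (Lam + lam) * l.
  have -> : M ^+ 2 + C = D * (r * (Lam + lam)).
    by rewrite /D divfK// gt_eqF// mulr_gt0.
  have DE : D <= Num.sqrt l.
    by rewrite (le_trans (ler_norm D))// -sqrtr_sqr ler_sqrt// ltW.
  rewrite mulrA [leRHS]mulrC ler_pM2r ?mulr_gt0// -[leRHS]sl expr2.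
  by rewrite ler_pM2l// sqrtr_gt0.
move: averages defect gI.
set S := \sum_(y <- X l) phi (y / l); set A := \sum_(y <- X l) _.
set G := \int[lebesgue_measure]_(x in `]0, 1[) g x.
set I := \int[lebesgue_measure]_(x in `]0, 1[) phi x.
move=> averages defect gI.
have averagesK :
    `|(Lam + lam) * (A - d * S)| <= (Lam + lam) * (2 * l * (2 * r)).
  by rewrite normrM (gtr0_norm K0) ler_pM2l.
have gIl : `|lam * l * (G - I)| <= lam * l * r.
  by rewrite normrM gtr0_norm ?mulr_gt0// ler_pM2l ?mulr_gt0.
have lLam : 0 <= Lam * l * r by rewrite !mulr_ge0// ltW.
have main : `|lam * l * I - d * (Lam + lam) * S| <= 6 * r * (Lam + lam) * l.
  move: averagesK gIl (le_trans defect small); rewrite !ler_norml.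
  by move=> /andP[? ?] /andP[? ?] /andP[? ?]; apply/andP; split; lra.
have dKl : 0 < d * (Lam + lam) * l by rewrite !mulr_gt0.
rewrite -(ler_pM2l dKl) -{1}(gtr0_norm dKl) -normrM.
rewrite (_ : _ * (_ - _) = lam * l * I - d * (Lam + lam) * S); last first.
  by field; rewrite !gt_eqF.
rewrite (le_trans main)// /r le_eqVlt; apply/orP; left; apply/eqP; field.
Unshelve. all: by end_near. Qed.
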